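(* Let $f:[0,1]\to\mathbb{R}$ be a bounded (measurable) function. Let $(\alpha_0(n))_{n\ge 1}$ and $(\alpha_1(n))_{n\ge 1}$ be real sequences with $2\alpha_0(n)+\alpha_1(n)=1$ for all $n$, and let $U_n^{1}$ be the associated modified genuine Bernstein-Durrmeyer operator. If $(\alpha_1(n))_n$ is a bounded sequence, then for every $n\ge 1$ $$\|U_n^{1}f-f\|\leq 2\left(3|\alpha_1(n)|+1\right)\omega\left(f;\frac{1}{\sqrt{n}}\right),$$ where $\|\cdot\|$ is the uniform norm on the interval $[0,1]$.
   Context: For integers $m\ge 0$ and $0\le k\le m$, let $p_{m,k}(x)=\binom{m}{k}x^k(1-x)^{m-k}$, $x\in[0,1]$. Given real sequences $\alpha_0(n),\alpha_1(n)$, put $\alpha(x,n)=\alpha_1(n)x+\alpha_0(n)$. The modified genuine Bernstein-Durrmeyer operator is $$U_n^{1}(f;x)=\alpha(x,n)(1-x)^{n-1}f(0)+\alpha(1-x,n)x^{n-1}f(1)+(n-1)\sum_{k=1}^{n-1}\left\{\alpha(x,n)p_{n-1,k}(x)+\alpha(1-x,n)p_{n-1,k-1}(x)\right\}\int_0^1 p_{n-2,k-1}(t)f(t)\,dt,$$ for $x\in[0,1]$, where the empty sum (case $n=1$) is $0$ and $0^0=1$. The condition $2\alpha_0(n)+\alpha_1(n)=1$ expresses that $U_n^1$ maps the constant function $1$ to itself. The first modulus of continuity is $\omega(f;\delta)=\sup\{|f(s)-f(t)|: s,t\in[0,1],\ |s-t|\le\delta\}$ for $\delta>0$. *)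

(* Defs.v *)
From HB Require Import structures.
From mathcomp Require Import all_boot all_order all_algebra.
From mathcomp Require Import all_classical all_reals all_analysis.

Set Implicit Arguments.
Unset Strict Implicit.
Unset Printing Implicit Defensive.

Import Order.TTheory GRing.Theory Num.Theory.
Import numFieldNormedType.Exports.

Local Open Scope classical_set_scope.
Local Open Scope ring_scope.

(* R with the sigma-algebra of Lebesgue measurable sets (the Caratheodory
   sigma-algebra of the outer measure generated by interval length), rather than
   the Borel sets, which are the canonical measurable sets on R. *)
Definition lebesgueType (R : realType) :=
  caratheodory_type ((@wlength R idfun)^*)%mu.

(* Only the values of f on [0, 1] matter. *)
Definition lebesgue_measurable01 (R : realType) (f : R -> R) : Prop :=
  @measurable_fun _ _ (lebesgueType R) (measurableTypeR R) `[0%R, 1%R] f.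

Definition bernstein_basis (R : realType) (m k : nat) (x : R) : R :=
  'C(m, k)%:R * x ^+ k * (1 - x) ^+ (m - k).

Definition alpha (R : realType) (alpha0 alpha1 : nat -> R) (x : R) (n : nat) :
  R := alpha1 n * x + alpha0 n.

(* Meant for n >= 1.  For n = 1 the sum is empty, so the truncated n - 2 is
   never evaluated there. *)
Definition genuine_BD (R : realType) (alpha0 alpha1 : nat -> R) (n : nat)
    (f : R -> R) (x : R) : R :=
  let p := @bernstein_basis R in
  let a y := alpha alpha0 alpha1 y n in
  a x * (1 - x) ^+ (n - 1) * f 0 + a (1 - x) * x ^+ (n - 1) * f 1 +
  (n - 1)%:R * \sum_(1 <= k < n)
    (a x * p (n - 1)%N k x + a (1 - x) * p (n - 1)%N (k - 1)%N x) *
    \int[@completed_lebesgue_measure R]_(t in `[0%R, 1%R])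
      (p (n - 2)%N (k - 1)%N t * f t).

(* The suprema below are taken in the extended reals, so that no value is
   assigned by convention to an unbounded set. *)
Definition modulus_of_continuity (R : realType) (f : R -> R) (delta : R) :
    \bar R :=
  ereal_sup [set z : \bar R | exists s t : R,
    [/\ 0 <= s <= 1, 0 <= t <= 1, `|s - t| <= delta & z = `|f s - f t|%:E]].

Definition uniform_norm01 (R : realType) (g : R -> R) : \bar R :=
  ereal_sup [set `|g x|%:E | x in `[0%R, 1%R]].

(* Main.v *)
Require Import Defs.
From mathcomp Require Import all_boot all_order all_algebra.
From mathcomp Require Import all_classical all_reals all_analysis.
From mathcomp Require Import measurable_realfun ring lra.
Import Order.TTheory GRing.Theory Num.Theory.
Import numFieldNormedType.Exports.
Local Open Scope classical_set_scope.
Local Open Scope ring_scope.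

(** Since [a x + a (1 - x) = 1], where [a x = alpha1 x + alpha0] is the weight
    function, the operator is an affine combination
    [U f x = a x * S0 + a (1 - x) * S1] of two Bernstein sums of degree [n - 1]
    in which the sampled values [f (k / n)] are replaced by the Durrmeyer
    averages [F k] of [f] against the densities [(n - 1) p_(n-2, k-1)], with
    [F 0 = f 0] and [F n = f 1]: [S0] samples [F k] and [S1] samples [F (k + 1)]
    ([genuine_BD_decomposition]).

    Each of the two sums is an average of values of [f], so only second moments
    are needed. Chaining steps of length [delta] gives
    [|f t - f x| <= w (1 + ((t - x) / delta)^2)] with [w] the modulus of
    continuity at [delta] ([dist_le_quadratic]); for [delta = 1 / sqrt n] the
    right-hand side is a parabola in [t]. Averaging it against the Durrmeyer
    densities, which are those of beta distributions, gives a parabola in [k]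
    ([durrmeyer_node_dist]), and the Bernstein sum of a parabola is explicit
    ([bernstein_sum_quadratic]). With [X = x (1 - x)] this yields
    [|S0 - f x| <= w (1 + (2 (n - 1) X + 2 x^2) / (n + 1))] and the mirror image
    of this bound for [S1]. The two fractions add up to at most 1, and both
    weights are at most [(1 + |alpha1|) / 2] in absolute value, so the error is
    at most [3 / 2 (1 + |alpha1|) w], which is below the required bound.

    The integrals in the operator are taken over the Lebesgue sigma-algebra,
    while beta integrals are computed over the Borel one; the identity map is
    measurable from the former to the latter and pushes the completed Lebesgue
    measure forward to the Lebesgue measure, which transfers them. *)

Lemma eq_ler (R : numDomainType) (a b : R) : a = b -> a <= b.
Proof. by move->. Qed.

(** * Transfer between Borel and Lebesgue measurability *)

Lemma measurable_borel_lebesgue (R : realType) (A : set R) :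
  measurable A ->
  measurable (A : set (lebesgueType R)).
Proof. by move=> mA; exact: sub_caratheodory. Qed.

Lemma measurable_lebesgue_itv01 (R : realType) :
  @measurable _ (lebesgueType R) `[0%R, 1%R].
Proof. by apply: measurable_borel_lebesgue; exact: measurable_itv. Qed.

(** The equality holds because the identity pushes the completed measure forward
    to the Lebesgue measure on Borel sets. *)
Lemma ge0_integral_completed_lebesgue (R : realType) (D : set R)
    (g : R -> \bar R) :
  measurable D -> measurable_fun D g ->
  (forall t, D t -> 0 <= g t)%E ->
  (\int[@completed_lebesgue_measure R]_(t in D) g t =
   \int[@lebesgue_measure R]_(t in D) g t)%E.
Proof.
move=> mD mg g0.
pose phi : lebesgueType R -> measurableTypeR R := fun t => t.
have mphi : measurable_fun setT phi.
  by move=> _ Y mY; rewrite setTI; exact: measurable_borel_lebesgue.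
(* The canonical measurable structure on R and measurableTypeR R carry
   different displays, hence the restatements. *)
have mg' : @measurable_fun _ _ (measurableTypeR R) _ D g by [].
have mD' : @measurable _ (measurableTypeR R) D by [].
transitivity (\int[pushforward (@completed_lebesgue_measure R) phi]_(t in D)
  g t)%E.
  apply/esym/(ge0_integral_pushforward mphi
    (@completed_lebesgue_measure R) mD' mg').
  by move=> t /set_mem; exact: g0.
exact: (@eq_measure_integral _ _ _ _ (@lebesgue_measure R)).
Qed.

(** * The Bernstein basis and its integrals *)

Lemma bernstein_basis_ge0 (R : realType) m k (x : R) :
  0 <= x <= 1 -> 0 <= bernstein_basis m k x.
Proof.
move=> /andP[x0 x1].
by rewrite /bernstein_basis !mulr_ge0 ?exprn_ge0// ?ler0n// subr_ge0.
Qed.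

Lemma bernstein_basisE (R : realType) m k :
  @bernstein_basis R m k = fun x => 'C(m, k)%:R * XMonemX k (m - k) x.
Proof. by apply/funext => x; rewrite /bernstein_basis /XMonemX mulrA. Qed.

Lemma measurable_bernstein_basis (R : realType) m k :
  measurable_fun (`[0%R, 1%R] : set R)
    (@bernstein_basis R m k).
Proof.
rewrite bernstein_basisE.
apply: measurable_funM; first exact: measurable_cst.
exact: measurable_XMonemX.
Qed.

Lemma integrable_bernstein_basis (R : realType) m k :
  (@completed_lebesgue_measure R).-integrable `[0%R, 1%R]
    (EFin \o @bernstein_basis R m k).
Proof.
have m01 : @measurable _ (measurableTypeR R) `[0%R, 1%R].
  exact: measurable_itv.
have mb := @measurable_bernstein_basis R m k.
apply/integrableP; split.
  move=> _ Y mY; apply: measurable_borel_lebesgue.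
  by move/measurable_EFinP : mb => mb; exact: mb.
rewrite ge0_integral_completed_lebesgue//; last first.
  exact/measurableT_comp/measurable_EFinP.
rewrite bernstein_basisE.
have := integrableZl m01 'C(m, k)%:R (@integrable_XMonemX R k (m - k)).
by move=> /integrableP[_]; under eq_integral do rewrite -EFinM.
Qed.

Lemma Rintegral_bernstein_basis (R : realType) m k : (k <= m)%N ->
  \int[@completed_lebesgue_measure R]_(t in `[0%R, 1%R]) bernstein_basis m k t
  = m.+1%:R^-1.
Proof.
move=> km.
have m01 : @measurable _ (measurableTypeR R) `[0%R, 1%R].
  exact: measurable_itv.
transitivity (\int[@lebesgue_measure R]_(t in `[0%R, 1%R])
    bernstein_basis m k t).
  congr fine; apply: ge0_integral_completed_lebesgue => //.
    by apply/measurable_EFinP; exact: measurable_bernstein_basis.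
  by move=> t /=; rewrite in_itv /= lee_fin; exact: bernstein_basis_ge0.
rewrite bernstein_basisE RintegralZl//; last exact: integrable_XMonemX.
have := @beta_fun_fact R k (m - k).
rewrite /beta_fun -Rintegral_mkcond/= => ->.
rewrite subnKC// mulrA -natrM bin_fact// factS natrM invfM mulrCA.
by rewrite divff ?mulr1.
Qed.

(** Absorbing a factor [x] into the next degree turns every moment of a basis
    polynomial into the plain integral of another one. *)
Lemma bernstein_basis_elevate (R : realType) m k (x : R) :
  x * bernstein_basis m k x =
  k.+1%:R / m.+1%:R * bernstein_basis m.+1 k.+1 x.
Proof.
rewrite /bernstein_basis subSS exprS.
have /(congr1 (GRing.natmul (1 : R))) := mul_bin_diag m.+1 k.
rewrite !natrM /= => e.
have m0 : m.+1%:R != 0 :> R by rewrite pnatr_eq0.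
apply: (mulfI m0).
transitivity (m.+1%:R * 'C(m, k)%:R * (x * x ^+ k * (1 - x) ^+ (m - k))).
  by ring.
by rewrite e; field; rewrite nat1r.
Qed.

Lemma integrable_bernstein_basisM (R : realType) (f : R -> R) m k :
  lebesgue_measurable01 f -> [bounded f t | t in `[0%R, 1%R]] ->
  (@completed_lebesgue_measure R).-integrable `[0%R, 1%R]
    (EFin \o (fun t => bernstein_basis m k t * f t)).
Proof.
move=> mf bf.
have m01 := measurable_lebesgue_itv01 R.
exact: (integrableMl m01 (integrable_bernstein_basis R m k) mf bf).
Qed.

Lemma bernstein_basis_quadraticE (R : realType) m k (c0 c1 c2 t : R) :
  bernstein_basis m k t * (c0 + c1 * t + c2 * t ^+ 2) =
  c0 * bernstein_basis m k t +
  (c1 * (k.+1%:R / m.+1%:R) * bernstein_basis m.+1 k.+1 t +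
   c2 * (k.+1%:R / m.+1%:R * (k.+2%:R / m.+2%:R)) *
     bernstein_basis m.+2 k.+2 t).
Proof.
transitivity (c0 * bernstein_basis m k t + (c1 * (t * bernstein_basis m k t) +
   c2 * (t * (t * bernstein_basis m k t)))); first by ring.
rewrite bernstein_basis_elevate (mulrCA t) bernstein_basis_elevate.
by ring.
Qed.

Lemma integrable_bernstein_basis_quadratic (R : realType) m k (c0 c1 c2 : R) :
  (@completed_lebesgue_measure R).-integrable `[0%R, 1%R]
    (EFin \o (fun t => bernstein_basis m k t * (c0 + c1 * t + c2 * t ^+ 2))).
Proof.
have m01 := measurable_lebesgue_itv01 R.
have ib c i j := integrableZl m01 c (integrable_bernstein_basis R i j).
rewrite (funext (bernstein_basis_quadraticE R m k c0 c1 c2)).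
exact: (integrableD m01 (ib _ _ _) (integrableD m01 (ib _ _ _) (ib _ _ _))).
Qed.

(** The mean and second moment of the beta density [(m + 1) p_(m, k)], namely
    [(k + 1) / (m + 2)] and [(k + 1) (k + 2) / ((m + 2) (m + 3))]. *)
Lemma Rintegral_bernstein_basis_quadratic (R : realType) m k (c0 c1 c2 : R) :
  (k <= m)%N ->
  \int[@completed_lebesgue_measure R]_(t in `[0%R, 1%R])
    (bernstein_basis m k t * (c0 + c1 * t + c2 * t ^+ 2)) =
  (c0 + c1 * (k.+1%:R / m.+2%:R) +
   c2 * (k.+1%:R * k.+2%:R / (m.+2%:R * m.+3%:R))) / m.+1%:R.
Proof.
move=> km.
have m01 := measurable_lebesgue_itv01 R.
have ib c i j := integrableZl m01 c (integrable_bernstein_basis R i j).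
rewrite (funext (bernstein_basis_quadraticE R m k c0 c1 c2)).
have i0 := ib c0 m k.
have i1 := ib (c1 * (k.+1%:R / m.+1%:R)) m.+1 k.+1.
have i2 := ib (c2 * (k.+1%:R / m.+1%:R * (k.+2%:R / m.+2%:R))) m.+2 k.+2.
have i12 := integrableD m01 i1 i2.
rewrite RintegralD// RintegralD// !RintegralZl//;
  try exact: integrable_bernstein_basis.
rewrite !Rintegral_bernstein_basis//.
have m_ge0 := ler0n R m.
by field; apply/and3P; split; apply: lt0r_neq0; lra.
Qed.

(** * Bernstein sums *)

(** Pascal's rule, which drives the induction on the degree of a Bernstein
    sum. *)
Lemma bernstein_basisSS (R : realType) m k (x : R) :
  bernstein_basis m.+1 k.+1 x =
  (1 - x) * bernstein_basis m k.+1 x + x * bernstein_basis m k x.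
Proof.
rewrite /bernstein_basis binS natrD subSS exprS.
have [km|mk] := ltnP k m; last by rewrite bin_small//; ring.
by rewrite -(subnSK km) exprS; ring.
Qed.

Lemma bernstein_basisS0 (R : realType) m (x : R) :
  bernstein_basis m.+1 0 x = (1 - x) * bernstein_basis m 0 x.
Proof. by rewrite /bernstein_basis !bin0 !subn0 exprS; ring. Qed.

Definition bernstein_sum {R : realType} (m : nat) (g : nat -> R) (x : R) : R :=
  \sum_(0 <= k < m.+1) bernstein_basis m k x * g k.

Lemma bernstein_sumS (R : realType) m (g : nat -> R) (x : R) :
  bernstein_sum m.+1 g x =
  (1 - x) * bernstein_sum m g x + x * bernstein_sum m (g \o S) x.
Proof.
rewrite /bernstein_sum big_nat_recl//= bernstein_basisS0.
rewrite (eq_bigr (fun k => (1 - x) * (bernstein_basis m k.+1 x * g k.+1) +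
   x * (bernstein_basis m k x * g k.+1))); last first.
  by move=> k _; rewrite bernstein_basisSS; ring.
rewrite big_split/= -!mulr_sumr addrA; congr (_ + _).
rewrite -mulrA -mulrDr; congr (_ * _).
rewrite [RHS]big_nat_recl// big_nat_recr//= addrA.
by rewrite [X in _ + X](_ : _ = 0) ?addr0// /bernstein_basis bin_small// !mul0r.
Qed.

(** The moments of the binomial distribution up to order 2. The coefficients are
    general so that the shift of the argument by 1 in [bernstein_sumS] stays
    within the statement proved by induction. *)
Lemma bernstein_sum_quadratic (R : realType) m (c0 c1 c2 x : R) :
  bernstein_sum m (fun k => c0 + c1 * k%:R + c2 * k%:R ^+ 2) x =
  c0 + c1 * (m%:R * x) + c2 * (m%:R * x * (1 - x) + (m%:R * x) ^+ 2).
Proof.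
elim: m c0 c1 c2 => [|m IH] c0 c1 c2.
  by rewrite /bernstein_sum big_nat1 /bernstein_basis bin0 subnn !expr0; ring.
rewrite bernstein_sumS IH.
rewrite [X in _ + x * X](_ : _ = bernstein_sum m
    (fun k => (c0 + c1 + c2) + (c1 + 2 * c2) * k%:R + c2 * k%:R ^+ 2) x).
  by rewrite IH; ring.
by apply: eq_bigr => k _ /=; ring.
Qed.

(** Bernstein sums are averages: the basis is nonnegative with sum 1. *)
Lemma bernstein_sum_dist (R : realType) m (g h : nat -> R) (c x : R) :
  0 <= x <= 1 -> (forall k, (k <= m)%N -> `|g k - c| <= h k) ->
  `|bernstein_sum m g x - c| <= bernstein_sum m h x.
Proof.
move=> x01 gh.
have e : bernstein_sum m (fun=> c) x = c.
  transitivity (bernstein_sum m (fun k => c + 0 * k%:R + 0 * k%:R ^+ 2) x).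
    by apply: eq_bigr => k _ /=; ring.
  by rewrite bernstein_sum_quadratic; ring.
rewrite -{1}e /bernstein_sum -sumrB.
apply: le_trans (ler_norm_sum _ _ _) _.
rewrite !big_mkord; apply: ler_sum => k _.
rewrite -mulrBr normrM ger0_norm ?bernstein_basis_ge0//.
by rewrite ler_wpM2l ?bernstein_basis_ge0// gh// -ltnS.
Qed.

(** * The Durrmeyer functionals *)

(** The functional attached to the node [k / n] by the genuine
    Bernstein-Durrmeyer operator. The point evaluations at [k = 0] and [k = n]
    are the degenerate limits of the beta densities used inside, so that moment
    formulas hold for all [k] alike. *)
Definition durrmeyer_node {R : realType} (f : R -> R) (n k : nat) : R :=
  if k == 0%N then f 0 else if k == n then f 1 else
  (n - 1)%:R * \int[@completed_lebesgue_measure R]_(t in `[0%R, 1%R])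
    (bernstein_basis (n - 2) (k - 1) t * f t).

(** The boundary terms of the operator are node [0] of the first sum and node
    [n] of the second, also when [n = 1]. *)
Lemma genuine_BD_decomposition (R : realType) (alpha0 alpha1 : nat -> R)
    (f : R -> R) (n : nat) (x : R) : (0 < n)%N ->
  genuine_BD alpha0 alpha1 n f x =
  alpha alpha0 alpha1 x n *
    bernstein_sum n.-1 (durrmeyer_node f n) x +
  alpha alpha0 alpha1 (1 - x) n *
    bernstein_sum n.-1 (durrmeyer_node f n \o S) x.
Proof.
case: n => [//|N _]; rewrite /genuine_BD/= !subn1/=.
set a := alpha _ _ x _; set b := alpha _ _ (1 - x) _.
have inner k : (1 <= k < N.+1)%N -> durrmeyer_node f N.+1 k =
    N%:R * \int[@completed_lebesgue_measure R]_(t in `[0%R, 1%R])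
      (bernstein_basis (N.+1 - 2) (k - 1) t * f t).
  case: k => [//|k] /andP[_ kN].
  by rewrite /durrmeyer_node/= (ltn_eqF kN) subn1.
have -> : bernstein_sum N (durrmeyer_node f N.+1) x = (1 - x) ^+ N * f 0 +
    \sum_(1 <= k < N.+1) bernstein_basis N k x * durrmeyer_node f N.+1 k.
  by rewrite /bernstein_sum big_ltn// /bernstein_basis bin0 subn0 expr0 !mul1r.
have -> : bernstein_sum N (durrmeyer_node f N.+1 \o S) x =
    (\sum_(1 <= k < N.+1)
      bernstein_basis N (k - 1) x * durrmeyer_node f N.+1 k) + x ^+ N * f 1.
  rewrite /bernstein_sum big_nat_recr//= {2}/durrmeyer_node/= eqxx.
  rewrite {2}/bernstein_basis binn subnn expr0 mul1r mulr1; congr (_ + _).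
  by rewrite big_add1/=; apply: eq_bigr => k _; rewrite subn1.
rewrite (_ : N%:R * _ = a * (\sum_(1 <= k < N.+1)
     bernstein_basis N k x * durrmeyer_node f N.+1 k) +
   b * (\sum_(1 <= k < N.+1)
     bernstein_basis N (k - 1) x * durrmeyer_node f N.+1 k)); last first.
  rewrite !mulr_sumr -big_split/=; apply: eq_big_nat => k kN.
  by rewrite inner//; ring.
ring.
Qed.

(** The right-hand side is the parabola [w (1 + n (t - x)^2)] averaged by the
    functional at node [k], that is, with [t] replaced by [k / n] and [t^2] by
    [k (k + 1) / (n (n + 1))]; it is expanded in powers of [k], ready for
    [bernstein_sum_quadratic]. Both end nodes satisfy the same formula. *)
Lemma durrmeyer_node_dist (R : realType) (f : R -> R) (n k : nat) (x w : R) :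
  lebesgue_measurable01 f -> [bounded f t | t in `[0%R, 1%R]] ->
  (0 < n)%N -> (k <= n)%N -> 0 <= x <= 1 ->
  (forall t, 0 <= t <= 1 -> `|f t - f x| <= w * (1 + n%:R * (t - x) ^+ 2)) ->
  `|durrmeyer_node f n k - f x| <=
  w * (1 + n%:R * x ^+ 2) + w * (n.+1%:R^-1 - 2 * x) * k%:R +
  w * n.+1%:R^-1 * k%:R ^+ 2.
Proof.
move=> mf bf n0 kn x01 fw.
have nR : 0 < n%:R :> R by rewrite ltr0n.
rewrite /durrmeyer_node; case: eqVneq => [->|k0].
  apply: le_trans (fw _ _) _; first by rewrite lexx ler01.
  by apply: eq_ler; ring.
case: eqVneq => [->|kn'].
  apply: le_trans (fw _ _) _; first by rewrite lexx ler01.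
  apply: eq_ler; field.
  by apply: lt0r_neq0; lra.
case: k kn k0 kn' => [//|j] jn _ jn'.
case: n n0 jn jn' nR fw => [//|[|m]] _ jn jn' nR fw.
  by move: jn jn'; case: j.
have jm : (j <= m)%N by move: jn; rewrite ltnS leq_eqVlt -eqSS (negbTE jn').
rewrite !subn1 subSS subn1/=.
have m01 := measurable_lebesgue_itv01 R.
have ipf := integrable_bernstein_basisM R f m j mf bf.
set N : R := m.+2%:R.
(* The parabolas f x + w (1 + N (t - x)^2) and f x - w (1 + N (t - x)^2),
   expanded in powers of t. *)
have Eu := Rintegral_bernstein_basis_quadratic R m j
  (f x + w * (1 + N * x ^+ 2)) (- (2 * N * x * w)) (N * w) jm.
have El := Rintegral_bernstein_basis_quadratic R m j
  (f x - w * (1 + N * x ^+ 2)) (2 * N * x * w) (- (N * w)) jm.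
have iq c0 c1 c2 := integrable_bernstein_basis_quadratic R m j c0 c1 c2.
have m_ge0 := ler0n R m.
rewrite ler_distl; apply/andP; split.
- apply: (@le_trans _ _ (m.+1%:R * (\int[@completed_lebesgue_measure R]_(t in
    `[0%R, 1%R]) (bernstein_basis m j t * (f x - w * (1 + N * x ^+ 2) +
      2 * N * x * w * t + - (N * w) * t ^+ 2))))).
    rewrite El /N; apply: eq_ler; field.
    by apply/and3P; split; apply: lt0r_neq0; lra.
  rewrite ler_wpM2l ?ler0n//; apply: (le_Rintegral m01 (iq _ _ _) ipf) => t.
  rewrite /= in_itv/= => t01; rewrite ler_wpM2l ?bernstein_basis_ge0//.
  have := fw t t01; rewrite ler_distl => /andP[+ _]; apply: le_trans.
  by apply: eq_ler; rewrite /N; ring.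
- apply: (@le_trans _ _ (m.+1%:R * (\int[@completed_lebesgue_measure R]_(t in
    `[0%R, 1%R]) (bernstein_basis m j t * (f x + w * (1 + N * x ^+ 2) +
      - (2 * N * x * w) * t + N * w * t ^+ 2))))).
    rewrite ler_wpM2l ?ler0n//; apply: (le_Rintegral m01 ipf (iq _ _ _)) => t.
    rewrite /= in_itv/= => t01; rewrite ler_wpM2l ?bernstein_basis_ge0//.
    have := fw t t01; rewrite ler_distl => /andP[_ +] => /le_trans; apply.
    by apply: eq_ler; rewrite /N; ring.
  rewrite Eu /N; apply: eq_ler; field.
  by apply/and3P; split; apply: lt0r_neq0; lra.
Qed.

(** Averaging the bound of [durrmeyer_node_dist] over [k] leaves
    [n E (t - x)^2 = (2 (n - 1) x (1 - x) + 2 x^2) / (n + 1)], where [t] follows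
    the mixture of the node functionals with binomial weights. *)
Lemma bernstein_sum_durrmeyer_dist (R : realType) (f : R -> R) (n : nat)
    (x w : R) :
  lebesgue_measurable01 f -> [bounded f t | t in `[0%R, 1%R]] ->
  (0 < n)%N -> 0 <= x <= 1 ->
  (forall t, 0 <= t <= 1 -> `|f t - f x| <= w * (1 + n%:R * (t - x) ^+ 2)) ->
  `|bernstein_sum n.-1 (durrmeyer_node f n) x - f x| <=
  w * (1 + (2 * (n%:R - 1) * (x * (1 - x)) + 2 * x ^+ 2) / n.+1%:R).
Proof.
move=> mf bf n0 x01 quad.
have nR : 1 <= n%:R :> R by rewrite ler1n.
have node k := durrmeyer_node_dist R f n k x w mf bf n0.
apply: le_trans (bernstein_sum_dist _ _ _ _ _ _ x01 (fun k kn =>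
  node k (leq_trans kn (leq_pred n)) x01 quad)) _.
rewrite bernstein_sum_quadratic.
have -> : n.-1%:R = n%:R - 1 :> R by rewrite -subn1 natrB.
apply: eq_ler; field.
by apply: lt0r_neq0; lra.
Qed.

Lemma bernstein_sum_durrmeyerS_dist (R : realType) (f : R -> R) (n : nat)
    (x w : R) :
  lebesgue_measurable01 f -> [bounded f t | t in `[0%R, 1%R]] ->
  (0 < n)%N -> 0 <= x <= 1 ->
  (forall t, 0 <= t <= 1 -> `|f t - f x| <= w * (1 + n%:R * (t - x) ^+ 2)) ->
  `|bernstein_sum n.-1 (durrmeyer_node f n \o S) x - f x| <=
  w * (1 + (2 * (n%:R - 1) * (x * (1 - x)) + 2 * (1 - x) ^+ 2) / n.+1%:R).
Proof.
move=> mf bf n0 x01 quad.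
have nR : 1 <= n%:R :> R by rewrite ler1n.
(* The bound at node k + 1, again expanded in powers of k. *)
have nodeS k : (k <= n.-1)%N -> `|(durrmeyer_node f n \o S) k - f x| <=
    w * (1 + n%:R * x ^+ 2 + (n.+1%:R^-1 - 2 * x) + n.+1%:R^-1) +
    w * (n.+1%:R^-1 - 2 * x + 2 * n.+1%:R^-1) * k%:R +
    w * n.+1%:R^-1 * k%:R ^+ 2.
  move=> kn; have kn' : (k.+1 <= n)%N by rewrite -(prednK n0).
  apply: le_trans (durrmeyer_node_dist R f n k.+1 x w mf bf n0 kn' x01 quad) _.
  by apply: eq_ler; ring.
apply: le_trans (bernstein_sum_dist _ _ _ _ _ _ x01 nodeS) _.
rewrite bernstein_sum_quadratic.
have -> : n.-1%:R = n%:R - 1 :> R by rewrite -subn1 natrB.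
apply: eq_ler; field.
by apply: lt0r_neq0; lra.
Qed.

(** * From the modulus of continuity to a quadratic bound *)

Lemma dist_le_chain (R : realType) (f : R -> R) (delta w : R) (m : nat) :
  (forall s t, 0 <= s <= 1 -> 0 <= t <= 1 -> `|s - t| <= delta ->
    `|f s - f t| <= w) ->
  forall t x, 0 <= t <= 1 -> 0 <= x <= 1 -> `|t - x| <= m%:R * delta ->
  `|f t - f x| <= m%:R * w.
Proof.
move=> fw; elim: m => [|m IH] t x t01 x01.
  by rewrite !mul0r normr_le0 subr_eq0 => /eqP ->; rewrite subrr normr0.
move=> tx.
pose s : R := m.+1%:R^-1.
have s0 : 0 < s by rewrite invr_gt0 ltr0n.
have s1 : s <= 1 by rewrite invf_le1 ?ltr0n// ler1n.
have sm : s * m.+1%:R = 1 by rewrite mulVf// pnatr_eq0.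
(* The last of m + 1 equal steps from x to t starts at y. *)
pose y := t + s * (x - t).
have y01 : 0 <= y <= 1.
  by move: t01 x01 => /andP[t0 t1] /andP[x0 x1]; rewrite /y; nra.
have ty : `|t - y| <= delta.
  rewrite (_ : t - y = s * (t - x)); last by rewrite /y; ring.
  rewrite normrM (gtr0_norm s0).
  by apply: le_trans (ler_wpM2l (ltW s0) tx) _; rewrite mulrA sm mul1r.
have yx : `|y - x| <= m%:R * delta.
  have -> : y - x = s * (m%:R * (t - x)).
    transitivity ((s * m.+1%:R - s) * (t - x)); last by ring.
    by rewrite sm /y; ring.
  rewrite !normrM (gtr0_norm s0) (ger0_norm (ler0n _ m)).
  rewrite mulrCA ler_wpM2l//.
  by apply: le_trans (ler_wpM2l (ltW s0) tx) _; rewrite mulrA sm mul1r.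
rewrite (_ : f t - f x = (f t - f y) + (f y - f x)); last by ring.
apply: le_trans (ler_normD _ _) _.
by have := fw t y t01 y01 ty; have := IH y x y01 x01 yx; lra.
Qed.

(** With [l = |t - x| / delta], [trunc l + 1] steps of length at most [delta]
    lead from [x] to [t]; and [trunc l <= l^2] because [trunc l] is an integer
    not exceeding [l]. *)
Lemma dist_le_quadratic (R : realType) (f : R -> R) (delta w : R) :
  0 < delta ->
  (forall s t, 0 <= s <= 1 -> 0 <= t <= 1 -> `|s - t| <= delta ->
    `|f s - f t| <= w) ->
  forall t x, 0 <= t <= 1 -> 0 <= x <= 1 ->
  `|f t - f x| <= w * (1 + ((t - x) / delta) ^+ 2).
Proof.
move=> d0 fw t x t01 x01.
have w0 : 0 <= w.
  have := fw x x x01 x01; rewrite !subrr !normr0.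
  by apply; exact: ltW.
pose l := `|t - x| / delta.
have l0 : 0 <= l by rewrite divr_ge0// ltW.
have -> : ((t - x) / delta) ^+ 2 = l ^+ 2.
  by rewrite /l !exprMn -normrX ger0_norm ?sqr_ge0.
have /andP[lt ltS] := truncn_itv l0.
set m := Num.truncn l in lt ltS.
have tx : `|t - x| <= m.+1%:R * delta.
  by rewrite -ler_pdivrMr// ltW.
apply: le_trans (dist_le_chain R f delta w m.+1 fw t x t01 x01 tx) _.
rewrite mulrC ler_wpM2l// -natr1 addrC lerD2l.
apply: (@le_trans _ _ (m%:R ^+ 2)); last by rewrite ler_pXn2r ?nnegrE.
by rewrite -natrX ler_nat; case: (m) => // p; rewrite leq_pmulr.
Qed.

(** * The estimate *)

Theorem theorem2p1 (R : realType) (f : R -> R) (alpha0 alpha1 : nat -> R)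
    (f_meas : lebesgue_measurable01 f)
    (f_bounded : [bounded f x | x in `[0%R, 1%R]])
    (alpha_unit : forall n : nat, (1 <= n)%N -> 2 * alpha0 n + alpha1 n = 1)
    (alpha1_bounded : [bounded alpha1 n | n in [set n : nat | (1 <= n)%N]])
    (n : nat) (n_ge1 : (1 <= n)%N) :
  (uniform_norm01 (fun x => genuine_BD alpha0 alpha1 n f x - f x)%R <=
   (2 * (3 * `|alpha1 n| + 1))%:E *
   modulus_of_continuity f (1 / Num.sqrt n%:R))%E.
Proof.
have nR : 1 <= n%:R :> R by rewrite ler1n.
have d0 : 0 < 1 / Num.sqrt n%:R :> R by rewrite divr_gt0// sqrtr_gt0; lra.
have osc s t : 0 <= s <= 1 -> 0 <= t <= 1 -> `|s - t| <= 1 / Num.sqrt n%:R ->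
    (`|f s - f t|%:E <= modulus_of_continuity f (1 / Num.sqrt n%:R))%E.
  by move=> s01 t01 st; apply: ereal_sup_ubound; exists s, t.
have K0 : 0 < 2 * (3 * `|alpha1 n| + 1) by have := normr_ge0 (alpha1 n); lra.
case: (modulus_of_continuity f _) osc => [w||] osc; last first.
- have z01 : 0 <= (0 : R) <= 1 by rewrite lexx ler01.
  by have := osc 0 0 z01 z01; rewrite subrr normr0 => /(_ (ltW d0)).
- by rewrite gt0_muley ?leey// lte_fin.
have fw s t : 0 <= s <= 1 -> 0 <= t <= 1 -> `|s - t| <= 1 / Num.sqrt n%:R ->
    `|f s - f t| <= w by move=> s01 t01 st; rewrite -lee_fin; exact: osc.
apply: ge_ereal_sup => _ [x /= + <-]; rewrite in_itv/= => x01.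
have quad t : 0 <= t <= 1 -> `|f t - f x| <= w * (1 + n%:R * (t - x) ^+ 2).
  move=> t01; apply: le_trans (dist_le_quadratic R f _ w d0 fw t x t01 x01) _.
  by rewrite div1r invrK exprMn sqr_sqrtr ?ler0n// mulrC (mulrC _ n%:R) mulrC.
have w0 : 0 <= w.
  by have := quad x x01; rewrite !subrr normr0 expr0n/= mulr0 addr0 mulr1.
have dist0 := bernstein_sum_durrmeyer_dist R f n x w
  f_meas f_bounded n_ge1 x01 quad.
have dist1 := bernstein_sum_durrmeyerS_dist R f n x w
  f_meas f_bounded n_ge1 x01 quad.
rewrite genuine_BD_decomposition// -EFinM lee_fin.
move: dist0 dist1.
set S0 := bernstein_sum _ _ _; set S1 := bernstein_sum _ _ _.
set e0 := (_ / _); set e1 := (_ / _) => dist0 dist1.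
(* The numerators add up to 2 + 4 (n - 2) x (1 - x), at most n + 1. *)
have e01 : e0 + e1 <= 1.
  rewrite /e0 /e1 -mulrDl ler_pdivrMr ?ltr0n// mul1r -natr1.
  by move: x01 => /andP[x0 x1]; have := sqr_ge0 (2 * x - 1); nra.
have au := alpha_unit n n_ge1.
have a1_ge0 := normr_ge0 (alpha1 n).
have /andP[a1l a1r] : - `|alpha1 n| <= alpha1 n <= `|alpha1 n|.
  by rewrite -ler_norml.
have weight y : 0 <= y <= 1 ->
    `|alpha alpha0 alpha1 y n| <= (1 + `|alpha1 n|) / 2.
  move=> /andP[y0 y1]; rewrite /alpha ler_norml; apply/andP; split; nra.
have y01 : 0 <= 1 - x <= 1 by move: x01 => /andP[? ?]; lra.
have weights1 : alpha alpha0 alpha1 x n + alpha alpha0 alpha1 (1 - x) n = 1.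
  by rewrite /alpha -[RHS]au; ring.
have -> : alpha alpha0 alpha1 x n * S0 + alpha alpha0 alpha1 (1 - x) n * S1 -
    f x = alpha alpha0 alpha1 x n * (S0 - f x) +
     alpha alpha0 alpha1 (1 - x) n * (S1 - f x).
  move: weights1; set a := alpha _ _ x n; set b := alpha _ _ (1 - x) n => ab.
  by rewrite -[X in _ - X = _]mul1r -ab; ring.
apply: le_trans (ler_normD _ _) _; rewrite !normrM.
apply: (@le_trans _ _ ((1 + `|alpha1 n|) / 2 * (w * (1 + e0)) +
  (1 + `|alpha1 n|) / 2 * (w * (1 + e1)))).
  by apply: lerD; apply: ler_pM => //; exact: weight.
rewrite -mulrDr -mulrDr.
apply: (@le_trans _ _ ((1 + `|alpha1 n|) / 2 * (w * 3))).
  by rewrite ler_wpM2l ?divr_ge0 ?addr_ge0// ler_wpM2l//; lra.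
by nra.
Qed.
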